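(* Let $G$ be a completely metrizable topological group with identity $e$, let $d$ be a left-invariant compatible metric on $G$, and let $T\colon G\to G$ be a continuous endomorphism of $G$. Suppose that $d$ is bounded or that $T$ is Lipschitz continuous with respect to $d$. Then the following assertions are equivalent: (1) $T$ admits a mean semi-irregular point; (2) $T$ admits a mean Li-Yorke chaotic pair; (3) $T$ is mean Li-Yorke chaotic; (4) $T$ is mean Li-Yorke sensitive; (5) the restriction of $T$ to some closed $T$-invariant subgroup $\widetilde{G}$ of $G$ has a dense (in $\widetilde G$) set of mean semi-irregular points.
   Context: A topological group is completely metrizable if its topology is induced by some complete metric. A compatible metric $d$ on $G$ is a metric inducing the topology of $G$ (not required to be complete); it is left-invariant if $d(zx,zy)=d(x,y)$ for all $x,y,z\in G$. A continuous endomorphism is a continuous group homomorphism $G\to G$. $T$ is Lipschitz continuous if there is $L>0$ with $d(Tx,Ty)\le L\,d(x,y)$ for all $x,y\in G$. A subset $Y\subset G$ is $T$-invariant if $TY\subset Y$. A point $x\in G$ is mean semi-irregular for $T$ if $\liminf_{n\to\infty}\frac1n\sum_{i=1}^n d(T^ix,e)=0$ and $\limsup_{n\to\infty}\frac1n\sum_{i=1}^n d(T^ix,e)>0$. A pair $(x,y)\in G\times G$ is mean Li-Yorke chaotic if $\liminf_{n\to\infty}\frac1n\sum_{i=1}^n d(T^ix,T^iy)=0$ and $\limsup_{n\to\infty}\frac1n\sum_{i=1}^n d(T^ix,T^iy)>0$. For $\delta>0$ it is mean Li-Yorke $\delta$-chaotic if the liminf is $0$ and the limsup is $\ge\delta$.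 $T$ is mean Li-Yorke chaotic if there exists an uncountable set $K\subset G$ such that any two distinct points of $K$ form a mean Li-Yorke chaotic pair. $T$ is mean Li-Yorke sensitive if there exists $\delta>0$ such that for every $x\in G$ and $\varepsilon>0$ there exists $y\in G$ with $d(x,y)<\varepsilon$ such that $(x,y)$ is mean Li-Yorke $\delta$-chaotic. *)

(* Defs.v *)
From HB Require Import structures.
From mathcomp Require Import all_boot all_order all_algebra.
From mathcomp Require Import all_classical all_reals all_analysis.

Set Implicit Arguments.
Unset Strict Implicit.
Unset Printing Implicit Defensive.

Import Order.TTheory GRing.Theory Num.Theory.
Import numFieldNormedType.Exports.

Local Open Scope classical_set_scope.
Local Open Scope ring_scope.

(* Multiplicative and possibly non-abelian; the library only has the additive,
   abelian [topologicalZmodType]. *)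
HB.mixin Record Topological_isTopologicalGroup G
    of Topological G & Group G := {
  mulg_continuous : continuous (fun x : G * G => (x.1 * x.2)%g) ;
  invg_continuous : continuous (fun x : G => (x^-1)%g) ;
}.

#[short(type="topologicalGroupType")]
HB.structure Definition TopologicalGroup :=
  {G of Topological G & Group G & Topological_isTopologicalGroup G}.

Section Metrics.
Context {R : realType} {X : Type}.
Implicit Type d : X -> X -> R.

Definition is_metric d : Prop :=
  [/\ forall x y, 0 <= d x y,
      forall x y, d x y = 0 <-> x = y,
      forall x y, d x y = d y x &
      forall x y z, d x z <= d x y + d y z].

Definition complete_metric d : Prop :=
  forall u : nat -> X,
    (forall eps : R, 0 < eps -> exists N : nat, forall m n : nat,
        (N <= m)%N -> (N <= n)%N -> d (u m) (u n) < eps) ->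
    exists l : X, d (u n) l @[n --> \oo] --> (0 : R).

Definition bounded_metric d : Prop := exists M : R, forall x y, d x y <= M.

Definition lipschitz_wrt d (T : X -> X) : Prop :=
  exists2 L : R, 0 < L & forall x y, d (T x) (T y) <= L * d x y.

End Metrics.

(* A metric inducing the given topology. *)
Definition compatible_metric {R : realType} {X : topologicalType}
    (d : X -> X -> R) : Prop :=
  is_metric d /\
  forall (x : X) (A : set X),
    nbhs x A <-> exists2 r : R, 0 < r & [set y | d x y < r] `<=` A.

Definition completely_metrizable (R : realType) (X : topologicalType) : Prop :=
  exists d : X -> X -> R, compatible_metric d /\ complete_metric d.

Definition left_invariant {R : realType} {G : groupType} (d : G -> G -> R) :
    Prop :=
  forall x y z : G, d (z * x)%g (z * y)%g = d x y.

Section MeanChaos.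
Context {R : realType} {X : Type}.
Variables (d : X -> X -> R) (T : X -> X).

(* (1/n) \sum_{i=1}^n d (T^i x) (T^i y).  It is valued in the extended reals
   because its limsup may be infinite; the junk term at n = 0 affects neither
   limsup nor liminf. *)
Definition mean_dist (x y : X) (n : nat) : \bar R :=
  (n%:R^-1 * \sum_(1 <= i < n.+1) d (iter i T x) (iter i T y))%:E.

(* (1/n) \sum_{i=1}^n d (T^i x) e *)
Definition mean_dist_to (e x : X) (n : nat) : \bar R :=
  (n%:R^-1 * \sum_(1 <= i < n.+1) d (iter i T x) e)%:E.

Definition mean_semi_irregular (e x : X) : Prop :=
  limn_einf (mean_dist_to e x) = 0%E /\ (0 < limn_esup (mean_dist_to e x))%E.

Definition mean_LY_pair (x y : X) : Prop :=
  limn_einf (mean_dist x y) = 0%E /\ (0 < limn_esup (mean_dist x y))%E.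

Definition mean_LY_delta_pair (delta : R) (x y : X) : Prop :=
  limn_einf (mean_dist x y) = 0%E /\
  (delta%:E <= limn_esup (mean_dist x y))%E.

Definition mean_LY_chaotic : Prop :=
  exists K : set X, ~ countable K /\
    forall x y : X, K x -> K y -> x <> y -> mean_LY_pair x y.

Definition mean_LY_sensitive : Prop :=
  exists2 delta : R, 0 < delta &
    forall (x : X) (eps : R), 0 < eps ->
      exists2 y : X, d x y < eps & mean_LY_delta_pair delta x y.

End MeanChaos.

Section Restriction.
Context {X : Type} (Y : set X).

(* [set_type Y] is the subset Y as a type; it carries the library's subset
   topology when X is a topological space. *)
Definition restrict_map (T : X -> X) (TY : T @` Y `<=` Y)
    (x : set_type Y) : set_type Y :=
  exist _ (T (val x)) (mem_set (TY _ (imageP T (set_valP x)))).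

Definition restrict_metric {R : realType} (d : X -> X -> R)
    (x y : set_type Y) : R :=
  d (val x) (val y).

End Restriction.

Definition subgroup_one {G : groupType} (H : set G)
    (gH : group_closed (mem H)) : set_type H :=
  exist _ 1%g gH.1.

(* Main.v *)
Require Import Defs.
From mathcomp Require Import all_boot all_order all_algebra.
From mathcomp Require Import all_classical all_reals all_analysis.
From mathcomp Require Import zify lra.

Set Implicit Arguments.
Unset Strict Implicit.
Unset Printing Implicit Defensive.

Import Order.TTheory GRing.Theory Num.Theory.
Import numFieldNormedType.Exports.

Local Open Scope classical_set_scope.
Local Open Scope ring_scope.

(** Left invariance turns every statement about pairs into one about points:
    the means of [(x, y)] are the means of the distances to [1] along the orbit
    of [x^-1 y]. So a mean Li-Yorke pair is a mean semi-irregular point, and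
    everything follows from one such point [g].

    Sensitivity: small means force the orbit of [g] to come arbitrarily close to
    [1], and a fixed shift of the orbit changes neither the smallness nor the
    largeness of infinitely many means ([semi_irregular_near1]). The points
    [x T^k g] near [x] are then the partners of [x].

    Dense semi-irregularity: fix times [m k] along which the means of [g] tend
    to [0], and let [N] be the set of all points whose means tend to [0] along
    the same times. By the triangle inequality [N] is a subgroup, and the
    boundedness of [d] or the Lipschitz condition makes it [T]-invariant
    ([null_along_endo]). A point [h] of [N] whose means are not large infinitely
    often is corrected by a factor [T^k g] close to [1]
    ([null_along_large_dense]), so that the points of [N] with infinitely many
    means above a fixed [e > 0] are dense in the closure [H] of [N].

    Chaos: fix countably many points of [H]. That [y] forms a mean Li-Yorke pair
    with each of them follows from countably many conditions on [y] that are
    open and dense in [H], and [H] is a closed subset of a completely metrizable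
    space, so the Baire argument [baire_closed] provides such a [y]
    ([common_LY_partner]). A maximal subset of [H] whose distinct points form
    mean Li-Yorke pairs is therefore uncountable. *)

(** * Upper and lower limits of extended real sequences *)

Section LimSupInf.
Context {R : realType}.
Implicit Types (u : nat -> \bar R) (a : \bar R).

Definition infinitely_often (P : nat -> Prop) : Prop :=
  forall N : nat, exists2 n, (N <= n)%N & P n.

Lemma lt_limn_esup_io u a :
  (a < limn_esup u)%E -> infinitely_often (fun n => (a < u n)%E).
Proof.
move=> au N.
have : (a < ereal_sup (u @` [set n | (N <= n)%N]))%E.
  apply: (lt_le_trans au); apply: ereal_inf_lbound.
  by exists [set n | (N <= n)%N] => //; exists N.
by move=> /ereal_sup_gt[_ [n Nn <-] aun]; exists n.
Qed.

Lemma io_le_limn_esup u a :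
  infinitely_often (fun n => (a <= u n)%E) -> (a <= limn_esup u)%E.
Proof.
move=> ioa; apply: le_ereal_inf_tmp => _ [V [N _ NV] <-].
have [n Nn aun] := ioa N.
by apply: (le_trans aun); apply: ereal_sup_ubound; exists n => //; apply: NV.
Qed.

Lemma limn_einf_lt_io u a :
  (limn_einf u < a)%E -> infinitely_often (fun n => (u n < a)%E).
Proof.
rewrite /limn_einf lteNl => /lt_limn_esup_io io N.
by have [n Nn] := io N; rewrite lteN2 => ?; exists n.
Qed.

Lemma io_limn_einf_le u a :
  infinitely_often (fun n => (u n <= a)%E) -> (limn_einf u <= a)%E.
Proof.
move=> io; rewrite /limn_einf leeNl; apply: io_le_limn_esup => N.
by have [n Nn ?] := io N; exists n => //; rewrite leeN2.
Qed.

Lemma limn_einf_ge0 u : (forall n, 0 <= u n)%E -> (0 <= limn_einf u)%E.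
Proof.
move=> u0; rewrite leNgt; apply/negP => /limn_einf_lt_io /(_ 0%N)[n _].
by rewrite ltNge u0.
Qed.

End LimSupInf.

(** * Cesaro means *)

Lemma invS_lt {R : realType} (e : R) k :
  0 < e -> (Num.truncn e^-1 <= k)%N -> k.+1%:R^-1 < e.
Proof.
move=> e0 ek; rewrite -[ltRHS]invrK ltf_pV2 ?posrE ?invr_gt0//.
by rewrite (lt_le_trans (truncnS_gt _))// ler_nat.
Qed.

Section Cesaro.
Context {R : realType}.
Implicit Types (a b c : nat -> R) (e : R).

Definition cesaro_mean a (n : nat) : R := n%:R^-1 * \sum_(1 <= i < n.+1) a i.

Definition cesaro_small_io a : Prop :=
  forall e, 0 < e -> infinitely_often (fun n => cesaro_mean a n < e).

Definition cesaro_large_io e a : Prop :=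
  infinitely_often (fun n => e < cesaro_mean a n).

Lemma cesaro_ge0 a n : (forall i, 0 <= a i) -> 0 <= cesaro_mean a n.
Proof. by move=> a0; rewrite mulr_ge0 ?invr_ge0 ?ler0n ?sumr_ge0. Qed.

Lemma ler_cesaro a b n :
  (forall i, a i <= b i) -> cesaro_mean a n <= cesaro_mean b n.
Proof. by move=> ab; rewrite ler_wpM2l ?invr_ge0 ?ler0n ?ler_sum. Qed.

Lemma cesaroD a b n :
  cesaro_mean (fun i => a i + b i) n = cesaro_mean a n + cesaro_mean b n.
Proof. by rewrite /cesaro_mean big_split mulrDr. Qed.

Lemma cesaroZ e a n : cesaro_mean (fun i => e * a i) n = e * cesaro_mean a n.
Proof. by rewrite /cesaro_mean -mulr_sumr mulrCA. Qed.

Lemma cesaro_shift a k n : (0 < n)%N ->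
  cesaro_mean (fun i => a (i + k)%N) n =
  (n + k)%:R / n%:R * cesaro_mean a (n + k) -
  n%:R^-1 * \sum_(1 <= i < k.+1) a i.
Proof.
move=> n0; rewrite /cesaro_mean.
have nk : (n + k)%:R != 0 :> R by rewrite pnatr_eq0 -lt0n addn_gt0 n0.
rewrite [X in _ = X - _]mulrA [X in X * _ - _]mulrAC divff// mul1r -mulrBr.
congr (_ * _).
rewrite (@big_cat_nat _ _ _ k.+1 1 (n + k).+1)//= ?ltnS ?leq_addl//.
rewrite addrAC subrr add0r -[in RHS](add1n k) big_addn.
by rewrite -addSn addnK.
Qed.

(** The mean of the shifted sequence at [n] is at most [(n + k) / n] times the
    mean of [a] at [n + k], and this factor is at most [2] once [k <= n]. *)
Lemma cesaro_small_shift a k : (forall i, 0 <= a i) ->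
  cesaro_small_io a -> cesaro_small_io (fun i => a (i + k)%N).
Proof.
move=> a0 sa e e0 N.
have [m km /=] := sa _ (divr_gt0 e0 (ltr0n _ 2)) (N + k + k.+1)%N.
have -> : m = (m - k + k)%N by lia.
set n := (m - k)%N => small.
have Nn : (N + k < n)%N by lia.
have n0 : (0 < n)%N by lia.
exists n; first by lia.
have n0R : 0 < n%:R :> R by rewrite ltr0n.
rewrite cesaro_shift//.
have s0 : 0 <= n%:R^-1 * \sum_(1 <= i < k.+1) a i.
  by rewrite mulr_ge0 ?invr_ge0 ?ler0n ?sumr_ge0.
have le2 : (n + k)%:R / n%:R <= 2 :> R.
  by rewrite ler_pdivrMr// -natrM ler_nat; lia.
have := ler_wpM2r (cesaro_ge0 (n + k) a0) le2.
lra.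
Qed.

(** The shift loses at most the first [k] terms, whose contribution [C / n] to
    the mean at [n] is eventually below [e]. *)
Lemma cesaro_large_shift e a k : 0 < e -> (forall i, 0 <= a i) ->
  cesaro_large_io (e + e) a -> cesaro_large_io e (fun i => a (i + k)%N).
Proof.
move=> e0 a0 la N.
set C := \sum_(1 <= i < k.+1) a i.
have [p Cp] : exists p : nat, C / e < p%:R.
  by exists (Num.truncn (C / e)).+1; exact: truncnS_gt.
have [m km /=] := la (N + p + k.+1)%N.
have -> : m = (m - k + k)%N by lia.
set n := (m - k)%N => large.
have Nn : (N + p < n)%N by lia.
have n0 : (0 < n)%N by lia.
exists n; first by lia.
have n0R : 0 < n%:R :> R by rewrite ltr0n.
rewrite cesaro_shift// -/C.
have Ce : n%:R^-1 * C < e.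
  rewrite mulrC ltr_pdivrMr// mulrC -ltr_pdivrMr// (lt_le_trans Cp)// ler_nat.
  by lia.
have ge1 : 1 <= (n + k)%:R / n%:R :> R.
  by rewrite ler_pdivlMr// mul1r ler_nat leq_addr.
have := ler_wpM2r (cesaro_ge0 (n + k) a0) ge1.
lra.
Qed.

Lemma cesaro_small_ex a e : cesaro_small_io a -> 0 < e -> exists i, a i < e.
Proof.
move=> sa e0; apply/not_existsP => ae.
have [n n1 /=] := sa _ e0 1%N; apply/negP; rewrite -leNgt.
rewrite /cesaro_mean mulrC ler_pdivlMr ?ltr0n//.
rewrite [leLHS](_ : _ = \sum_(1 <= i < n.+1) e); last first.
  by rewrite sumr_const_nat subn1 mulr_natr.
by apply: ler_sum => i _; rewrite leNgt; apply/negP/ae.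
Qed.

Lemma limn_einf_cesaroP a : (forall i, 0 <= a i) ->
  limn_einf (fun n => (cesaro_mean a n)%:E) = 0%E <-> cesaro_small_io a.
Proof.
move=> a0; split=> [e0 e ep N|sa].
  have : (limn_einf (fun n => (cesaro_mean a n)%:E) < e%:E)%E.
    by rewrite e0 lte_fin.
  by move=> /limn_einf_lt_io /(_ N)[n Nn]; rewrite lte_fin; exists n.
apply/eqP; rewrite eq_le; apply/andP; split; last first.
  by apply: limn_einf_ge0 => n; rewrite lee_fin cesaro_ge0.
apply/lee_addgt0Pr => e e0; rewrite add0e.
apply: io_limn_einf_le => N.
by have [n Nn ?] := sa _ e0 N; exists n => //; rewrite lee_fin ltW.
Qed.

Lemma cesaro_large_limn_esup e a : cesaro_large_io e a ->
  (e%:E <= limn_esup (fun n => (cesaro_mean a n)%:E))%E.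
Proof.
move=> la; apply: io_le_limn_esup => N.
by have [n Nn ?] := la N; exists n => //; rewrite lee_fin ltW.
Qed.

Lemma limn_esup_cesaro_large a :
  (0 < limn_esup (fun n => (cesaro_mean a n)%:E))%E ->
  exists2 e, 0 < e & cesaro_large_io e a.
Proof.
case E : limn_esup => [r| |]//.
- rewrite lte_fin => r0; exists (r / 2); first by rewrite divr_gt0.
  move=> N; have : ((r / 2)%:E < limn_esup (fun n => (cesaro_mean a n)%:E))%E.
    by rewrite E lte_fin; lra.
  by move=> /lt_limn_esup_io /(_ N)[n Nn]; rewrite lte_fin; exists n.
- move=> _; exists 1 => // N.
  have : (1%:E < limn_esup (fun n => (cesaro_mean a n)%:E))%E by rewrite E ltry.
  by move=> /lt_limn_esup_io /(_ N)[n Nn]; rewrite lte_fin; exists n.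
Qed.

End Cesaro.

(** * Metrics compatible with a topology, and a Baire argument *)

Section CompatibleMetric.
Context {R : realType} {X : topologicalType} {d : X -> X -> R}.
Hypothesis dX : compatible_metric d.

Let d_ge0 : forall x y, 0 <= d x y. Proof. by case: dX => -[]. Qed.
Let d_sym : forall x y, d x y = d y x. Proof. by case: dX => -[]. Qed.
Let d_tri : forall x y z, d x z <= d x y + d y z.
Proof. by case: dX => -[]. Qed.
Let d_refl x : d x x = 0.
Proof. by case: dX => -[_ d0 _ _] _; apply/d0. Qed.

Lemma metric_ball_nbhs x r : 0 < r -> nbhs x [set y | d x y < r].
Proof. by move=> r0; apply/(dX.2 x); exists r. Qed.

Lemma metric_closureP (A : set X) x :
  closure A x <-> forall r, 0 < r -> exists2 y, A y & d x y < r.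
Proof.
split=> [Ax r /metric_ball_nbhs /Ax[y [Ay dxy]]|Ax B /(dX.2 x)[r r0 rB]].
  by exists y.
by have [y Ay /rB By] := Ax _ r0; exists y.
Qed.

Lemma metric_dist_continuous x : continuous (d x : X -> R).
Proof.
move=> y; apply/cvgrPdist_lt => e e0.
near=> z.
have yz : d y z < e by near: z; exact: metric_ball_nbhs.
rewrite ltr_norml.
have := d_tri x y z; have := d_tri x z y; have := d_sym z y.
by move=> ? ? ?; apply/andP; split; lra.
Unshelve. all: by end_near. Qed.

(** Baire category for a closed set, by the usual nested closed balls. The
    density of each [W n] is only asked for at points of [H], which avoids
    putting a topology and a metric on [H] itself. *)
Lemma baire_closed (H : set X) (W : nat -> set X) :
  complete_metric d -> closed H -> H !=set0 ->
  (forall n, open (W n)) ->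
  (forall n x B, H x -> nbhs x B -> exists y, [/\ H y, W n y & B y]) ->
  exists2 x, H x & forall n, W n x.
Proof.
move=> dcomp Hc [x0 Hx0] Wo Wd.
(* A state is the current step, the center and the radius of the ball. *)
pose inv (p : nat * X * R) := H p.1.2 /\ 0 < p.2.
pose St := {p : nat * X * R | inv p}.
pose rel (p q : St) := [/\ (sval q).1.1 = (sval p).1.1.+1,
  (sval q).2 < (sval p).1.1.+1%:R^-1 &
  forall y, d (sval q).1.2 y <= (sval q).2 ->
     d (sval p).1.2 y <= (sval p).2 /\ W (sval p).1.1 y].
have step (p : St) : {q : St | rel p q}.
  apply: cid; case: p => [[[n x] r] [/= Hx r0]].
  have [y [Hy Wy /= xy]] := Wd n x _ Hx (metric_ball_nbhs x r0).
  have /(dX.2 y)[s s0 sW] := open_nbhs_nbhs (conj (Wo n) Wy).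
  pose t := Order.min (s / 2) (Order.min ((r - d x y) / 2) (n.+1%:R^-1 / 2)).
  have n0 : 0 < n.+1%:R^-1 :> R by rewrite invr_gt0.
  have xyr : 0 < r - d x y by rewrite subr_gt0.
  have t0 : 0 < t by rewrite !lt_min !divr_gt0.
  have : t <= t by [].
  rewrite {2}/t !le_min => /and3P[ts tr tn].
  exists (exist inv (n.+1, y, t) (conj Hy t0)); split=> //=.
    by rewrite (le_lt_trans tn)// ltr_pdivrMr// ltr_pMr ?ltr1n.
  move=> z yz; split.
    have := d_tri x y z; lra.
  by apply: sW => /=; lra.
have [f [f0 fS]] :=
  dependent_choice step (exist inv (0%N, x0, 1) (conj Hx0 ltr01)).
pose x n := (sval (f n)).1.2; pose r n := (sval (f n)).2.
have fn n : (sval (f n)).1.1 = n.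
  by elim: n => [|n IH]; [rewrite f0 | have [-> _ _] := fS n; rewrite IH].
have r0 n : 0 < r n by have [] := svalP (f n).
have Hx n : H (x n) by have [] := svalP (f n).
have rS n : r n.+1 < n.+1%:R^-1 by have [_ + _] := fS n; rewrite fn.
have nest n y : d (x n.+1) y <= r n.+1 -> d (x n) y <= r n /\ W n y.
  by have [_ _ +] := fS n; rewrite fn; apply.
have nested n k y : d (x (n + k)%N) y <= r (n + k)%N -> d (x n) y <= r n.
  elim: k => [|k IH]; first by rewrite addn0.
  by rewrite addnS => /nest[/IH].
have xx n k : d (x n) (x (n + k)%N) <= r n.
  by apply: (nested n k); rewrite d_refl ltW.
have [e e0|l xl] := dcomp x.
  pose N := Num.truncn (e / 2)^-1.
  have Ne : N.+1%:R^-1 < e / 2 by rewrite invS_lt// divr_gt0.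
  have rN : r N.+1 < e / 2 by exact: lt_trans (rS N) Ne.
  exists N.+1 => m n Nm Nn.
  have := xx N.+1 (m - N.+1)%N; have := xx N.+1 (n - N.+1)%N.
  rewrite !subnKC// => xn xm.
  have := d_tri (x m) (x N.+1) (x n); rewrite (d_sym (x m) (x N.+1)).
  lra.
have lball n : d (x n) l <= r n.
  apply/ler_addgt0Pr => e e0.
  have /cvgrPdist_lt/(_ _ e0)[N _ NP] := xl.
  have := NP (n + N)%N; rewrite /= leq_addl => /(_ isT).
  rewrite sub0r normrN ger0_norm// => xNl.
  have := d_tri (x n) (x (n + N)%N) l; have := xx n N; lra.
exists l; last by move=> n; have [] := nest n l (lball n.+1).
apply: Hc; apply/metric_closureP => e e0.
have /cvgrPdist_lt/(_ _ e0)[N _ NP] := xl.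
exists (x N) => //; have := NP N (leqnn N).
by rewrite sub0r normrN ger0_norm// d_sym.
Qed.

End CompatibleMetric.

(** * Closures, countable sets and restrictions *)

Lemma closure_group_closed (G : topologicalGroupType) (A : set G) :
  A 1%g -> (forall x y, A x -> A y -> A (x * y)%g) ->
  (forall x, A x -> A x^-1%g) -> group_closed (mem (closure A)).
Proof.
move=> A1 AM AV; split=> [|x y]; first by apply/mem_set/subset_closure.
rewrite !inE => Ax Ay B /= xyB.
have [U Ux UB] : exists2 U : set (G * G), nbhs (x, y^-1%g) U &
    U `<=` [set p | B (p.1 * p.2)%g].
  exists [set p | B (p.1 * p.2)%g] => //.
  exact: (mulg_continuous (x, y^-1%g)).
have [[U1 U2] /= [Ux1 Uy2] U12] := Ux.
have /Ax[x' [Ax' Ux']] := Ux1.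
have /Ay[y' [Ay' Uy']] := @invg_continuous G y U2 Uy2.
exists (x' * y'^-1)%g; split; first exact: AM (AV _ Ay').
by apply: (UB (x', y'^-1%g)); apply: U12.
Qed.

Lemma closure_invariant (X : topologicalType) (f : X -> X) (A : set X) :
  continuous f -> (forall x, A x -> A (f x)) ->
  f @` closure A `<=` closure A.
Proof.
move=> cf Af _ [x Ax <-] B /cf /Ax[y [Ay By]].
by exists (f y); split=> //; exact: Af.
Qed.

Lemma countable_subset_range {X : Type} (K A : set X) : countable K ->
  K `<=` A -> A !=set0 ->
  exists2 u : nat -> X, forall i, A (u i) & forall x, K x -> exists i, u i = x.
Proof.
move=> cK KA [a Aa].
have /countable_injP[f finj] := cK.
have /choice[u uP] : forall n, exists y,
    A y /\ forall x, K x -> f x = n -> y = x.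
  move=> n; have [[x [Kx fx]]|nx] := pselect (exists x, K x /\ f x = n).
    exists x; split; first exact: KA.
    by move=> y Ky fy; apply: finj; rewrite ?inE// fy.
  by exists a; split=> // x Kx fx; case: nx; exists x.
exists u => [i|x Kx]; first by have [] := uP i.
by exists (f x); have [_] := uP (f x); apply.
Qed.

Section Restrict.
Context {R : realType} {G : topologicalGroupType} {d : G -> G -> R}
  {T : {multiplicative G -> G}} (H : set G) (gH : group_closed (mem H))
  (TH : T @` H `<=` H).

Lemma val_iter_restrict i (x : set_type H) :
  val (iter i (restrict_map TH) x) = iter i T (val x).
Proof. by elim: i => //= i <-. Qed.

Lemma restrict_semi_irregularE (x : set_type H) :
  mean_semi_irregular (restrict_metric (Y := H) d) (restrict_map TH)
    (subgroup_one gH) x = mean_semi_irregular d T 1%g (val x).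
Proof.
rewrite /mean_semi_irregular.
suff -> : mean_dist_to (restrict_metric (Y := H) d) (restrict_map TH)
    (subgroup_one gH) x = mean_dist_to d T 1%g (val x) by [].
apply/funext => n; rewrite /mean_dist_to; congr (_ * _)%:E.
by apply: eq_bigr => i _; rewrite /restrict_metric val_iter_restrict.
Qed.

End Restrict.

(** * Orbit means of an endomorphism *)

Section Endomorphism.
Context {R : realType} {G : topologicalGroupType} {d : G -> G -> R}
  {T : {multiplicative G -> G}}.
Hypotheses (dG : compatible_metric d) (dleft : left_invariant d)
  (Tcont : continuous T).

Let d_ge0 : forall x y, 0 <= d x y. Proof. by case: dG => -[]. Qed.
Let d_sym : forall x y, d x y = d y x. Proof. by case: dG => -[]. Qed.
Let d_tri : forall x y z, d x z <= d x y + d y z.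
Proof. by case: dG => -[]. Qed.
Let d_refl x : d x x = 0.
Proof. by case: dG => -[_ d0 _ _] _; apply/d0. Qed.

Lemma left_invariantE x y : d x y = d (x^-1 * y)%g 1%g.
Proof. by rewrite -(dleft x y x^-1%g) mulVg d_sym. Qed.

Lemma iter_gmulfM i x y : iter i T (x * y)%g = (iter i T x * iter i T y)%g.
Proof. by elim: i => //= i ->; rewrite gmulfM. Qed.

Lemma endo1 : T 1%g = 1%g.
Proof. by apply: (mulgI (T 1%g)); rewrite -gmulfM !mulg1. Qed.

Lemma iter_endo1 i : iter i T 1%g = 1%g.
Proof. by elim: i => //= i ->; exact: endo1. Qed.

Lemma iter_endoV i x : iter i T x^-1%g = (iter i T x)^-1%g.
Proof.
by apply: (mulgI (iter i T x)); rewrite -iter_gmulfM !mulgV iter_endo1.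
Qed.

Definition orbit_dist (g : G) (i : nat) : R := d (iter i T g) 1%g.

Lemma orbit_dist_ge0 g i : 0 <= orbit_dist g i.
Proof. exact: d_ge0. Qed.

Lemma dist_iterE x y i :
  d (iter i T x) (iter i T y) = orbit_dist (x^-1 * y)%g i.
Proof. by rewrite left_invariantE -iter_endoV -iter_gmulfM. Qed.

Lemma orbit_distV g : orbit_dist g^-1%g = orbit_dist g.
Proof.
by apply/funext => i; rewrite -[g^-1%g]mulg1 -dist_iterE iter_endo1.
Qed.

(** The path from [1] to [g h] passes through [g], and left invariance turns its
    second leg into a path from [1] to [h]. *)
Lemma orbit_distM g h i :
  orbit_dist (g * h)%g i <= orbit_dist g i + orbit_dist h i.
Proof.
rewrite {1}/orbit_dist; apply: le_trans (d_tri _ (iter i T g) _) _.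
by rewrite addrC lerD2l d_sym dist_iterE mulKg.
Qed.

Lemma orbit_dist_iter g k :
  orbit_dist (iter k T g) = fun i => orbit_dist g (i + k)%N.
Proof. by apply/funext => i; rewrite /orbit_dist -iterD. Qed.

Lemma mean_distE x y :
  mean_dist d T x y = (fun n => (cesaro_mean (orbit_dist (x^-1 * y)%g) n)%:E).
Proof.
apply/funext => n; rewrite /mean_dist /cesaro_mean; congr (_ * _)%:E.
by apply: eq_bigr => i _; rewrite dist_iterE.
Qed.

Lemma mean_LY_pairP x y :
  mean_LY_pair d T x y <-> mean_semi_irregular d T 1%g (x^-1 * y)%g.
Proof. by rewrite /mean_LY_pair mean_distE. Qed.

Lemma mean_LY_pair_sym x y : mean_LY_pair d T x y -> mean_LY_pair d T y x.
Proof. by rewrite /mean_LY_pair !mean_distE -orbit_distV invgM invgK. Qed.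

Lemma semi_irregularP g : mean_semi_irregular d T 1%g g <->
  cesaro_small_io (orbit_dist g) /\
  exists2 e, 0 < e & cesaro_large_io e (orbit_dist g).
Proof.
have g0 := orbit_dist_ge0 g; split=> [[sg lg]|[sg [e e0 lg]]]; split.
- exact/(limn_einf_cesaroP g0).
- exact: limn_esup_cesaro_large.
- exact/(limn_einf_cesaroP g0).
- by apply: lt_le_trans (cesaro_large_limn_esup lg); rewrite lte_fin.
Qed.

Lemma mean_LY_pair_irrefl x : ~ mean_LY_pair d T x x.
Proof.
rewrite mean_LY_pairP mulVg => /semi_irregularP[_ [e e0 /(_ 0%N)[n _]]].
rewrite /cesaro_mean big1 ?mulr0 => [|i _]; first by rewrite ltNge ltW.
by rewrite /orbit_dist iter_endo1 d_refl.
Qed.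

(** Small means force the orbit of [g] to return close to [1], and a shift of
    the orbit affects neither the small nor the large means. Hence one
    semi-irregular point yields others arbitrarily close to [1], all with the
    same lower bound on their upper mean. *)
Lemma semi_irregular_near1 g e eps : 0 < e -> 0 < eps ->
  cesaro_small_io (orbit_dist g) -> cesaro_large_io (e + e) (orbit_dist g) ->
  exists k, [/\ d 1%g (iter k T g) < eps,
    cesaro_small_io (orbit_dist (iter k T g)) &
    cesaro_large_io e (orbit_dist (iter k T g))].
Proof.
move=> e0 eps0 sg lg; have g0 := orbit_dist_ge0 g.
have [k gk] := cesaro_small_ex sg eps0.
exists k; rewrite orbit_dist_iter; split; first by rewrite d_sym.
  exact: cesaro_small_shift.
exact: cesaro_large_shift.
Qed.

Lemma semi_irregular_sensitive g :
  mean_semi_irregular d T 1%g g -> mean_LY_sensitive d T.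
Proof.
move=> /semi_irregularP[sg [e e0 lg]].
have e20 : 0 < e / 2 by rewrite divr_gt0.
rewrite [e]splitr in lg.
exists (e / 2) => // x eps eps0.
have [k [near1 sk lk]] := semi_irregular_near1 e20 eps0 sg lg.
exists (x * iter k T g)%g; first by rewrite -{1}[x]mulg1 dleft.
rewrite /mean_LY_delta_pair mean_distE mulKg; split.
  exact/(limn_einf_cesaroP (orbit_dist_ge0 _)).
exact: cesaro_large_limn_esup.
Qed.

(** * The subgroup of points with vanishing means along given times *)

Definition null_along (m : nat -> nat) : set G := [set g | forall e, 0 < e ->
  exists K, forall k, (K <= k)%N -> cesaro_mean (orbit_dist g) (m k) < e].

Section NullGroup.
Variable m : nat -> nat.
Hypothesis m_ge : forall k, (k <= m k)%N.
Hypothesis bl : bounded_metric d \/ lipschitz_wrt d T.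

Lemma null_along1 : null_along m 1%g.
Proof.
move=> e e0; exists 0%N => k _; rewrite /cesaro_mean big1 ?mulr0// => i _.
by rewrite /orbit_dist iter_endo1.
Qed.

Lemma null_alongM g h :
  null_along m g -> null_along m h -> null_along m (g * h)%g.
Proof.
move=> ng nh e e0; have e20 : 0 < e / 2 by rewrite divr_gt0.
have [K KP] := ng _ e20; have [L LP] := nh _ e20.
exists (maxn K L) => k; rewrite geq_max => /andP[/KP gk /LP hk].
apply: le_lt_trans (ler_cesaro _ (orbit_distM g h)) _.
by rewrite cesaroD [e]splitr ltrD.
Qed.

Lemma null_alongV g : null_along m g -> null_along m g^-1%g.
Proof. by rewrite /null_along /= orbit_distV. Qed.

(** Passing from [g] to [T g] drops the first term of the orbit sum and adds
    one at the end. A bounded metric makes that term negligible after division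
    by [m k]; a Lipschitz constant bounds the new sum by a multiple of the old
    one. *)
Lemma null_along_endo g : null_along m g -> null_along m (T g).
Proof.
move=> ng e e0; have e20 : 0 < e / 2 by rewrite divr_gt0.
have Tg : orbit_dist (T g) = fun i => orbit_dist g i.+1.
  by apply/funext => i; rewrite -addn1 (orbit_dist_iter g 1).
rewrite Tg; case: bl => [[M dM]|[L L0 dL]].
- have [K KP] := ng _ e20.
  pose p := (Num.truncn (M / (e / 2))).+1.
  exists (maxn K p) => k; rewrite geq_max => /andP[/KP gk pk].
  have mk : (p <= m k)%N by rewrite (leq_trans pk).
  have mk0 : 0 < (m k)%:R :> R by rewrite ltr0n (leq_trans _ mk).
  have Mk : (m k)%:R^-1 * M < e / 2.
    rewrite mulrC ltr_pdivrMr// mulrC -ltr_pdivrMr//.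
    by rewrite (lt_le_trans (truncnS_gt _))// ler_nat.
  rewrite [e]splitr; apply: le_lt_trans (ltrD gk Mk).
  rewrite /cesaro_mean -mulrDr ler_wpM2l ?invr_ge0 ?ler0n//.
  rewrite -(big_add1 _ _ _ (m k).+2 xpredT).
  apply: (@le_trans _ _ (\sum_(1 <= i < (m k).+2) orbit_dist g i)).
    by rewrite [leRHS]big_ltn// lerDr orbit_dist_ge0.
  by rewrite big_nat_recr//= lerD2l; exact: dM.
- have [K KP] := ng _ (divr_gt0 e0 L0).
  exists K => k /KP; rewrite ltr_pdivlMr// mulrC -cesaroZ.
  apply: le_lt_trans; apply: ler_cesaro => i.
  by rewrite /orbit_dist iterS -{1}endo1; exact: dL.
Qed.

Lemma null_along_iter k g : null_along m g -> null_along m (iter k T g).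
Proof. by move=> ng; elim: k => //= k; exact: null_along_endo. Qed.

Lemma null_along_small g : null_along m g -> cesaro_small_io (orbit_dist g).
Proof.
move=> ng e /ng[K KP] N; exists (m (maxn K N)).
  by rewrite (leq_trans _ (m_ge _))// leq_maxr.
by apply: KP; rewrite leq_maxl.
Qed.

(** If the means of [g] are not already large infinitely often, they are
    eventually at most [e], and multiplying [g] by a point of the orbit of [g0]
    close to [1], whose means exceed [2e], makes them large. *)
Lemma null_along_large_dense g0 e g r : 0 < e -> null_along m g0 ->
  cesaro_large_io (e + e + (e + e)) (orbit_dist g0) ->
  null_along m g -> 0 < r ->
  exists h, [/\ null_along m h, d g h < r & cesaro_large_io e (orbit_dist h)].
Proof.
move=> e0 n0 l0 ng r0.
have [lg|] := pselect (cesaro_large_io e (orbit_dist g)).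
  by exists g; rewrite d_refl.
move=> /existsNP[N gN].
have [k [near1 sk lk]] :=
  semi_irregular_near1 (addr_gt0 e0 e0) r0 (null_along_small n0) l0.
exists (g * iter k T g0)%g; split.
- by apply: null_alongM => //; exact: null_along_iter.
- by rewrite -{1}[g]mulg1 dleft.
- move=> N'; have [n Nn ln] := lk (maxn N N').
  move: Nn; rewrite geq_max => /andP[Nn N'n]; exists n => //=.
  have gn : cesaro_mean (orbit_dist g) n <= e.
    by rewrite leNgt; apply/negP => ?; apply: gN; exists n.
  have := ler_cesaro n (orbit_distM g^-1%g (g * iter k T g0)%g).
  by rewrite mulKg cesaroD orbit_distV; lra.
Qed.

End NullGroup.

Lemma null_along_exists g : cesaro_small_io (orbit_dist g) ->
  exists m : nat -> nat, (forall k, (k <= m k)%N) /\ null_along m g.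
Proof.
move=> sg.
have /choice[m mP] : forall k, exists n, (k <= n)%N /\
    cesaro_mean (orbit_dist g) n < k.+1%:R^-1.
  by move=> k; have [|n] := sg k.+1%:R^-1 _ k; rewrite ?invr_gt0//; exists n.
exists m; split=> [k|e e0]; first by have [] := mP k.
exists (Num.truncn e^-1) => k Kk; have [_ /lt_trans] := mP k; apply.
exact: invS_lt.
Qed.

(** * A mean Li-Yorke chaotic set *)

Lemma iter_continuous i : continuous (iter i T).
Proof.
elim: i => [|i IH] x; first exact: cvg_id.
by apply: continuous_comp; [exact: IH | exact: Tcont].
Qed.

Lemma cesaro_dist_continuous x n : continuous (fun y =>
  cesaro_mean (fun i => d (iter i T x) (iter i T y)) n : R).
Proof.
move=> y; apply: cvgM; first exact: cvg_cst.
apply: cvg_big => [|i _]; first exact: add_continuous.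
apply: (@continuous_comp _ _ _ (iter i T) (d (iter i T x))).
  exact: iter_continuous.
exact: metric_dist_continuous.
Qed.

(** For each [i], the points [u i * s] with [s] in [S] form mean Li-Yorke pairs
    with [u i], and they are dense in [H] because left translation by [u i] is
    an isometry of [d] mapping [H] onto itself. The smallness and largeness
    conditions are unions of open sets, since only finitely many iterates enter
    each mean. The metric [rho] carries the completeness and [d] the
    invariance. *)
Lemma common_LY_partner (rho : G -> G -> R) (H S : set G) (e : R)
    (u : nat -> G) :
  compatible_metric rho -> complete_metric rho ->
  closed H -> group_closed (mem H) -> S `<=` H ->
  (forall x r, H x -> 0 < r -> exists2 s, S s & d x s < r) ->
  0 < e -> (forall s, S s -> cesaro_small_io (orbit_dist s) /\
    cesaro_large_io e (orbit_dist s)) ->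
  (forall i, H (u i)) ->
  exists2 y, H y & forall i, mean_LY_pair d T (u i) y.
Proof.
move=> rhoG rhoc Hc gH SH Sd e0 SP Hu.
pose mean x n y := cesaro_mean (fun i => d (iter i T x) (iter i T y)) n.
have meanE x n y :
    mean x n y = cesaro_mean (orbit_dist (x^-1 * y)%g) n.
  by congr (_ * _); apply: eq_bigr => i _; exact: dist_iterE.
pose small x N := \bigcup_(n in [set n | (N <= n)%N])
  [set y | mean x n y < N.+1%:R^-1].
pose large x N := \bigcup_(n in [set n | (N <= n)%N]) [set y | e < mean x n y].
(* The pairs [(i, N)] are enumerated by their codes; other numbers impose no
   condition. *)
pose W k := if unpickle k is Some (i, N) then small (u i) N `&` large (u i) N
            else setT.
have HM x y : H x -> H y -> H (x * y)%g.
  by move=> /mem_set xH /mem_set yH; exact/set_mem/(group_closedM gH).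
have HV x : H x -> H x^-1%g.
  by move=> /mem_set xH; exact/set_mem/(group_closedV gH).
have [|k|k x B Hx|y Hy yW] := baire_closed (W := W) rhoG rhoc Hc.
- by exists 1%g; apply/set_mem; case: gH.
- rewrite /W; case: unpickle => [[i N]|]; last exact: openT.
  apply: openI; apply: bigcup_open => n _.
    apply: (@open_comp _ _ (mean (u i) n) [set z | z < N.+1%:R^-1]).
      by move=> ? _; exact: cesaro_dist_continuous.
    exact: open_lt.
  apply: (@open_comp _ _ (mean (u i) n) [set z | e < z]).
    by move=> ? _; exact: cesaro_dist_continuous.
  exact: open_gt.
- move=> xB; rewrite /W; case: unpickle => [[i N]|]; last first.
    by exists x; split=> //; exact: nbhs_singleton.
  have /(dG.2 x)[r r0 rB] := xB.
  have [s Ss xs] := Sd _ r (HM _ _ (HV _ (Hu i)) Hx) r0.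
  exists (u i * s)%g; split; first exact: HM (SH _ Ss).
    have [sms lgs] := SP _ Ss; split.
      have [|n Nn ?] := sms N.+1%:R^-1 _ N; first by rewrite invr_gt0.
      by exists n; rewrite //= meanE mulKg.
    by have [n Nn ?] := lgs N; exists n; rewrite //= meanE mulKg.
  by apply: rB; rewrite /= -(dleft _ _ (u i)^-1%g) mulKg.
- exists y => // i; apply/mean_LY_pairP/semi_irregularP.
  have yWi N : small (u i) N y /\ large (u i) N y.
    by have := yW (pickle (i, N)); rewrite /W pickleK.
  split=> [c c0 N|].
    have [[n /= Nn] + _] := yWi (maxn N (Num.truncn c^-1)).
    rewrite meanE /= => nc; exists n.
      by rewrite (leq_trans _ Nn)// leq_maxl.
    by apply: (lt_trans nc); rewrite invS_lt// leq_maxr.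
  exists e => // N; have [_ [n /= Nn]] := yWi N; rewrite meanE => ne.
  by exists n.
Qed.

(** By Zorn's lemma there is a maximal subset of [H] whose distinct points form
    mean Li-Yorke pairs. If it were countable, its points would have a common
    partner in [H]; that partner is a new point, as no point is paired with
    itself, and it would extend the maximal set. *)
Lemma chaotic_of_countable_partner (H : set G) : H !=set0 ->
  (forall u : nat -> G, (forall i, H (u i)) ->
    exists2 y, H y & forall i, mean_LY_pair d T (u i) y) ->
  mean_LY_chaotic d T.
Proof.
move=> H0 partner.
pose P (K : set G) := K `<=` H /\
  forall x y, K x -> K y -> x <> y -> mean_LY_pair d T x y.
have [F FP Fchain|K [[KH KP] Kmax]] := @Zorn_bigcup G P.
  split=> [x [A FA Ax]|x y [A FA Ax] [B FB By]].
    by have [+ _] := FP _ FA; apply.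
  have [AB|BA] := Fchain _ _ FA FB.
    by have [_ +] := FP _ FB; apply=> //; exact: AB.
  by have [_ +] := FP _ FA; apply=> //; exact: BA.
exists K; split=> // cK.
have [u Hu uK] := countable_subset_range cK KH H0.
have [y Hy yP] := partner u Hu.
have yK x : K x -> mean_LY_pair d T x y by move=> /uK[i <-].
have nKy : ~ K y by move=> /yK; exact: mean_LY_pair_irrefl.
apply: (Kmax (K `|` [set y])).
  by split=> [x Kx|/(_ y)]; [left | move=> /(_ (or_intror erefl))].
split=> [x [/KH//|->//]|x z [Kx|->] [Kz|->] xz].
- exact: KP.
- exact: yK.
- by apply: mean_LY_pair_sym; exact: yK.
- by [].
Qed.

(** The group [H] is the closure of the group of points with vanishing means
    along times chosen for [g0]. The uniform bound [e] on [S] is what makes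
    largeness a countable intersection of open conditions in the Baire
    argument. *)
Lemma semi_irregular_closure g0 : bounded_metric d \/ lipschitz_wrt d T ->
  mean_semi_irregular d T 1%g g0 ->
  exists (H S : set G) (e : R), [/\ closed H, group_closed (mem H),
    T @` H `<=` H, 0 < e &
   [/\ S `<=` H, forall x r, H x -> 0 < r -> exists2 s, S s & d x s < r &
    forall s, S s -> cesaro_small_io (orbit_dist s) /\
      cesaro_large_io e (orbit_dist s)]].
Proof.
move=> bl /semi_irregularP[sg [e e0 lg]].
have [m [m_ge ng]] := null_along_exists sg.
pose N : set G := null_along m.
(* One halving pays for the shift of the orbit of [g0], the other for the
   multiplication by a point of the orbit. *)
pose c := e / 2 / 2.
have c0 : 0 < c by rewrite !divr_gt0.
exists (closure N), [set s | N s /\ cesaro_large_io c (orbit_dist s)], c.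
split=> //.
- exact: closed_closure.
- apply: closure_group_closed; first exact: null_along1.
    by move=> x y; exact: null_alongM.
  by move=> x; exact: null_alongV.
- by apply: closure_invariant => // x; exact: null_along_endo.
split=> [s [Ns _]|x r|s [Ns ls]]; first exact: subset_closure.
- move=> /(metric_closureP dG) Nx r0; have r20 : 0 < r / 2 by rewrite divr_gt0.
  have [g Ng xg] := Nx _ r20.
  have [|h [Nh gh lh]] := null_along_large_dense m_ge bl c0 ng _ Ng r20.
    by rewrite -!splitr.
  by exists h => //; have := d_tri x g h; lra.
- by split=> //; exact: null_along_small Ns.
Qed.

End Endomorphism.

Theorem theorem4p15 (R : realType) (G : topologicalGroupType)
    (d : G -> G -> R) (T : {multiplicative G -> G}) :
  completely_metrizable R G ->
  compatible_metric d ->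
  left_invariant d ->
  continuous T ->
  bounded_metric d \/ lipschitz_wrt d T ->
  [<-> exists x : G, mean_semi_irregular d T 1%g x;
       exists x y : G, mean_LY_pair d T x y;
       mean_LY_chaotic d T;
       mean_LY_sensitive d T;
       exists (H : set G) (gH : group_closed (mem H)) (TH : T @` H `<=` H),
         closed H /\
         dense [set x : set_type H |
           mean_semi_irregular (restrict_metric (Y := H) d) (restrict_map TH)
             (subgroup_one gH) x]].
Proof.
move=> [rho [rhoG rhoc]] dG dleft Tcont bl.
have pair_irr x y : mean_LY_pair d T x y ->
    exists g : G, mean_semi_irregular d T 1%g g.
  by move=> xy; exists (x^-1 * y)%g; exact/mean_LY_pairP.
tfae.
- move=> [g gP]; exists 1%g, g; apply/mean_LY_pairP => //.
  by rewrite invg1 mul1g.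
- move=> [x [y /pair_irr[g gP]]].
  have [H [S [e [Hc gH _ e0 [SH Sd SP]]]]] :=
    semi_irregular_closure dG dleft Tcont bl gP.
  apply: (@chaotic_of_countable_partner _ _ _ _ dG dleft H).
    by exists 1%g; apply/set_mem; case: gH.
  move=> u; exact:
    (common_LY_partner dG dleft Tcont rhoG rhoc Hc gH SH Sd e0 SP).
- move=> [K [nK KP]].
  have [x [y [Kx Ky xy]]] : exists x y, [/\ K x, K y & x <> y].
    apply: contra_notP nK => nxy.
    have [->|/set0P[x Kx]] := eqVneq K set0; first exact: countable0.
    apply: (@sub_countable _ _ _ [set x]) => //; apply: subset_card_le => y Ky.
    by apply: contrapT => /nesym xy; apply: nxy; exists x, y.
  by have /pair_irr[g] := KP x y Kx Ky xy; exact: semi_irregular_sensitive.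
- move=> [e e0 /(_ 1%g 1 ltr01)[y _ [sy ly]]].
  have /pair_irr[g gP] : mean_LY_pair d T 1%g y.
    by split=> //; apply: lt_le_trans ly; rewrite lte_fin.
  have [H [S [c [Hc gH TH c0 [SH Sd SP]]]]] :=
    semi_irregular_closure dG dleft Tcont bl gP.
  exists H, gH, TH; split=> // O [h Oh] [U Uo UO].
  have Uh : U (val h) by rewrite -UO in Oh.
  have /(dG.2 (val h))[r r0 rU] := open_nbhs_nbhs (conj Uo Uh).
  have [s Ss hs] := Sd _ _ (set_valP h) r0.
  exists (exist _ s (mem_set (SH _ Ss))); split.
    by rewrite -UO /=; exact: rU.
  rewrite /= restrict_semi_irregularE; apply/semi_irregularP => //.
  by have [? ?] := SP _ Ss; split=> //; exists c.
- move=> [H [gH [TH [_ Hd]]]].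
  have [|x [_ xP]] := Hd setT _ openT; first by exists (subgroup_one gH).
  by exists (val x); rewrite -(restrict_semi_irregularE gH TH).
Qed.
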